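(* The lower bound $\operatorname{bdim}(G)=\Omega(\log(\operatorname{adim}(G)))$ (valid for all graphs $G$) is asymptotically optimal: there is a family of graphs $G$ with $\operatorname{adim}(G)\to\infty$ and $\operatorname{bdim}(G)=O(\log(\operatorname{adim}(G)))$.
   Context: All graphs are finite, simple and undirected. $d(u,v)$ denotes graph distance ($\infty$ between different components), and for a positive integer $k$, $d_k(u,v)=\min\{d(u,v),k+1\}$. A function $f:V(G)\to\mathbb{Z}_{\ge0}$ is a resolving broadcast of $G$ if for any distinct $x,y\in V(G)$ there is $z$ with $f(z)>0$ and $d_{f(z)}(x,z)\ne d_{f(z)}(y,z)$; $\operatorname{bdim}(G)$ is the minimum of $\sum_v f(v)$ over resolving broadcasts $f$. A set $A\subseteq V(G)$ is an adjacency resolving set if for any distinct $x,y\in V(G)$ there is $z\in A$ with $d_1(x,z)\ne d_1(y,z)$; $\operatorname{adim}(G)$ is the minimum size of an adjacency resolving set. *)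

(* Defs.v *)
From mathcomp Require Import all_boot all_order all_algebra.
From mathcomp Require Import all_classical all_reals all_analysis.

Set Implicit Arguments.
Unset Strict Implicit.
Unset Printing Implicit Defensive.

Record sgraph := SGraph {
  vertex :> finType;
  adj : rel vertex;
  adj_sym : symmetric adj;
  adj_irrefl : irreflexive adj }.

Definition has_walk (G : sgraph) (u v : G) (n : nat) : bool :=
  [exists p : n.-tuple G, path (@adj G) u p && (last u p == v)].

Lemma connect_has_walk (G : sgraph) (u v : G) :
  connect (@adj G) u v -> exists n, has_walk u v n.
Proof.
case/connectP=> p up ->; exists (size p).
by apply/existsP; exists (in_tuple p); rewrite up eqxx.
Qed.

(* [None] is the infinite distance between different components. *)
Definition dist (G : sgraph) (u v : G) : option nat :=
  if @idP (connect (@adj G) u v) is ReflectT uv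
  then Some (ex_minn (connect_has_walk uv)) else None.

Definition trunc_dist (G : sgraph) (k : nat) (u v : G) : nat :=
  if dist u v is Some n then minn n k.+1 else k.+1.

Definition resolving_broadcast (G : sgraph) (f : G -> nat) : Prop :=
  forall x y : G, x <> y -> exists z : G,
    0 < f z /\ trunc_dist (f z) x z <> trunc_dist (f z) y z.

Definition adjacency_resolving (G : sgraph) (A : {set G}) : Prop :=
  forall x y : G, x <> y -> exists2 z : G,
    z \in A & trunc_dist 1 x z <> trunc_dist 1 y z.

Lemma trunc_dist_eq0 (G : sgraph) (k : nat) (u v : G) :
  (trunc_dist k u v == 0) = (u == v).
Proof.
have walk0 : has_walk u v 0 = (u == v).
  apply/existsP/eqP => [[p]|->]; first by rewrite tuple0 /= => /eqP.
  by exists [tuple]; rewrite /= eqxx.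
rewrite /trunc_dist /dist; case: {-}_ / idP => [uv|nuv].
  case: ex_minnP => -[|m] wm min_m; first by rewrite -walk0 wm min0n.
  rewrite minnSS -walk0; apply/esym/negbTE/negP => w0.
  by have := min_m _ w0.
by apply/esym/eqP => uv; apply: nuv; rewrite uv connect0.
Qed.

Lemma ex_resolving_broadcast (G : sgraph) :
  exists n, `[< exists2 f : G -> nat,
    resolving_broadcast f & \sum_(v : G) f v = n >].
Proof.
exists (\sum_(v : G) 1); apply/asboolP; exists (fun=> 1) => // x y xy.
exists x; split=> // e; apply: xy; apply/esym/eqP.
by rewrite -(trunc_dist_eq0 1) -e trunc_dist_eq0.
Qed.

Lemma ex_adjacency_resolving (G : sgraph) :
  exists n, `[< exists2 A : {set G}, adjacency_resolving A & #|A| = n >].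
Proof.
exists #|[set: G]|; apply/asboolP; exists [set: G] => // x y xy.
exists x; rewrite ?inE // => e; apply: xy; apply/esym/eqP.
by rewrite -(trunc_dist_eq0 1) -e trunc_dist_eq0.
Qed.

Definition bdim (G : sgraph) : nat := ex_minn (ex_resolving_broadcast G).

Definition adim (G : sgraph) : nat := ex_minn (ex_adjacency_resolving G).

(* Main.v *)
(**
A vertex [x] is determined by the vector of its truncated distances to the
support of a resolving broadcast [f], whose entry at [z] takes at most
[f z + 2 <= 3 ^ f z] values; hence [adim G <= #|G| <= 3 ^ bdim G].

For the converse, take [m] hubs and, for every set [x] of hubs, a path made of
a leaf and a middle vertex, the latter being joined to the hubs in [x].  Hubs
broadcasting with strength 2 see the leaf of [x] within distance 2 exactly when
they belong to [x], so total strength [O(m)] suffices to resolve the graph.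
On the other hand the closed neighbourhoods of the [2 ^ m] leaves are pairwise
disjoint, and an adjacency resolving set can miss at most one of them.
*)
Require Import Defs.
From mathcomp Require Import all_boot all_order all_algebra.
From mathcomp Require Import all_classical all_reals all_analysis.

Set Implicit Arguments.
Unset Strict Implicit.
Unset Printing Implicit Defensive.

Import Order.TTheory GRing.Theory Num.Theory.
Import numFieldNormedType.Exports.

Lemma has_walk0 (G : sgraph) (u v : G) : has_walk u v 0 = (u == v).
Proof.
apply/existsP/eqP => [[p]|->]; first by rewrite tuple0 /= => /eqP.
by exists [tuple]; rewrite /= eqxx.
Qed.

Lemma has_walkS (G : sgraph) (u v : G) n :
  has_walk u v n.+1 = [exists w, adj u w && has_walk w v n].
Proof.
apply/existsP/existsP => [[p]|[w /andP[uw /existsP[p wp]]]].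
  case/tupleP: p => w p /= /andP[/andP[uw wp] pv].
  by exists w; rewrite uw; apply/existsP; exists p; rewrite wp.
by exists [tuple of w :: p]; rewrite /= uw.
Qed.

Lemma has_walk1 (G : sgraph) (u v : G) : has_walk u v 1 = adj u v.
Proof.
rewrite has_walkS; apply/existsP/idP => [[w]|uv].
  by rewrite has_walk0 => /andP[uw /eqP <-].
by exists v; rewrite uv has_walk0 eqxx.
Qed.

Lemma trunc_dist_leS (G : sgraph) k (u v : G) : trunc_dist k u v <= k.+1.
Proof. by rewrite /trunc_dist; case: dist => // n; rewrite geq_minr. Qed.

(** Since [n <= k], the cap [k.+1] exceeds [n], so neither truncation nor an infinite distance
    affects the comparison. *)
Lemma trunc_dist_leP (G : sgraph) k n (u v : G) : n <= k ->
  reflect (exists2 j, j <= n & has_walk u v j) (trunc_dist k u v <= n).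
Proof.
move=> nk; apply: (iffP idP); rewrite /trunc_dist /dist.
  case: {-}_ / idP => [uv|_]; last by rewrite leqNgt ltnS nk.
  case: ex_minnP => j wj _; rewrite geq_min => /orP[jn|]; first by exists j.
  by rewrite leqNgt ltnS nk.
case=> j jn wj; case: {-}_ / idP => [uv|[]].
  by case: ex_minnP => i _ /(_ _ wj) ij; rewrite geq_min (leq_trans ij jn).
case/existsP: wj => p /andP[up /eqP pv].
by apply/connectP; exists p.
Qed.

Lemma trunc_dist_le1 (G : sgraph) k (u v : G) : 0 < k ->
  (trunc_dist k u v <= 1) = (u == v) || adj u v.
Proof.
move=> k_gt0; rewrite -has_walk0 -has_walk1.
apply/(trunc_dist_leP _ _ k_gt0)/orP => [[[|[|//]] _]|[|]].
- by left.
- by right.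
- by exists 0.
- by exists 1.
Qed.

Lemma trunc_dist_le2 (G : sgraph) k (u v : G) : 1 < k ->
  (trunc_dist k u v <= 2) =
  [|| u == v, adj u v | [exists w, adj u w && adj w v]].
Proof.
move=> k_gt1; have ->: [exists w, adj u w && adj w v] = has_walk u v 2.
  by rewrite has_walkS; apply: eq_existsb => w; rewrite has_walk1.
rewrite -has_walk0 -has_walk1.
apply/(trunc_dist_leP _ _ k_gt1)/or3P => [[[|[|[|//]]] _]|[|  |]].
- by constructor 1.
- by constructor 2.
- by constructor 3.
- by exists 0.
- by exists 1.
- by exists 2.
Qed.

Lemma bdim_le (G : sgraph) (f : G -> nat) :
  resolving_broadcast f -> bdim G <= \sum_(v : G) f v.
Proof.
move=> fP; rewrite /bdim; case: ex_minnP => n _; apply.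
by apply/asboolP; exists f.
Qed.

Lemma bdim_attained (G : sgraph) :
  exists2 f : G -> nat, resolving_broadcast f & \sum_(v : G) f v = bdim G.
Proof. by rewrite /bdim; case: ex_minnP => n /asboolP. Qed.

Lemma adim_attained (G : sgraph) :
  exists2 A : {set G}, adjacency_resolving A & #|A| = adim G.
Proof. by rewrite /adim; case: ex_minnP => n /asboolP. Qed.

Lemma adim_le_card (G : sgraph) : adim G <= #|G|.
Proof. by have [A _ <-] := adim_attained G; apply: max_card. Qed.

Lemma card_le_broadcast (G : sgraph) (f : G -> nat) :
  resolving_broadcast f -> #|G| <= 3 ^ \sum_(v : G) f v.
Proof.
move=> fP; pose T (z : G) := 'I_(3 ^ f z).-1.+1.
have cardT z : #|T z| = 3 ^ f z by rewrite card_ord prednK ?expn_gt0.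
(* This fails at [f z = 0], where [T z] is a singleton and the entry at [z] is lost; but only
   vertices with [f z > 0] are called on to resolve. *)
have T_bound z : 0 < f z -> (f z).+1 < (3 ^ f z).-1.+1.
  rewrite prednK ?expn_gt0 //; case: (f z) => // k _.
  elim: k => // k IHk; rewrite expnS; apply: leq_trans (leq_mul (leqnn 3) IHk).
  by rewrite mulSn -addn1 leq_add2l muln_gt0.
pose code (x : G) : {dffun forall z, T z} :=
  [ffun z => inord (trunc_dist (f z) x z)].
have code_inj : injective code.
  move=> x y /ffunP exy; case: (eqVneq x y) => // /eqP /fP[z [fz]] [].
  have := congr1 val (exy z); rewrite !ffunE /=.
  by rewrite !inordK // (leq_ltn_trans (trunc_dist_leS _ _ _)) ?T_bound.
have := leq_card code code_inj; rewrite card_dep_ffun.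
rewrite foldrE big_map big_enum /= expn_sum.
by rewrite (eq_bigr _ (fun z _ => cardT z)).
Qed.

Section HubGraph.

Variable m : nat.

(* [inl i] is a hub; [inr (x, false)] and [inr (x, true)] are the leaf and the
   middle vertex of [x]. *)
Definition hub_vertex : finType := ('I_m + {set 'I_m} * bool)%type.

Definition hub_adj : rel hub_vertex := fun u v =>
  match u, v with
  | inl i, inr (x, b) => b && (i \in x)
  | inr (x, b), inl i => b && (i \in x)
  | inr (x, a), inr (y, b) => (x == y) && (a != b)
  | inl _, inl _ => false
  end.

Lemma hub_adj_sym : symmetric hub_adj.
Proof. by move=> [i|[x a]] [j|[y b]] //=; rewrite eq_sym [a == b]eq_sym. Qed.

Lemma hub_adj_irrefl : irreflexive hub_adj.
Proof. by move=> [i|[x a]] //=; rewrite !eqxx. Qed.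

Definition hub_graph : sgraph := SGraph hub_adj_sym hub_adj_irrefl.

Definition hub (i : 'I_m) : hub_graph := inl i.
Definition path_vertex (x : {set 'I_m}) (b : bool) : hub_graph := inr (x, b).

Lemma path_hub_le1 (x : {set 'I_m}) b i :
  (trunc_dist 2 (path_vertex x b) (hub i) <= 1) = b && (i \in x).
Proof. by rewrite trunc_dist_le1. Qed.

(** A walk enters a hub from a middle vertex, and distinct paths are not joined, so within two steps
    that middle vertex is the one of [x]. *)
Lemma path_hub_le2 (x : {set 'I_m}) b i :
  (trunc_dist 2 (path_vertex x b) (hub i) <= 2) = (i \in x).
Proof.
rewrite trunc_dist_le2 //=; apply/idP/idP => [|ix].
  case/orP => [/andP[]//|/existsP[[j|[y c]] /=]]; first by rewrite andbF.
  by case/andP=> /andP[/eqP -> _] /andP[].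
case: b => /=; first by rewrite ix.
by apply/existsP; exists (path_vertex x true); rewrite /= eqxx ix.
Qed.

(* The two vertices of the path of [set0] see no hub, so one of them has to
   broadcast. *)
Definition hub_broadcast (v : hub_graph) : nat :=
  match v with
  | inl _ => 2
  | inr (x, b) => 2 * ((x == finset.set0) && b)
  end.

Lemma hub_broadcast_resolving : resolving_broadcast hub_broadcast.
Proof.
(* Only [u] itself is at truncated distance 0 from [u], so a vertex of positive strength separates
   itself from all others. *)
have self (u v : hub_graph) : u <> v ->
      0 < hub_broadcast u \/ 0 < hub_broadcast v ->
  exists z, 0 < hub_broadcast z /\
    trunc_dist (hub_broadcast z) u z <> trunc_dist (hub_broadcast z) v z.
  move=> uv [fz|fz].
    exists u; split=> // e; apply: uv; apply/esym/eqP.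
    by rewrite -(trunc_dist_eq0 (hub_broadcast u)) -e trunc_dist_eq0.
  exists v; split=> // e; apply: uv; apply/eqP.
  by rewrite -(trunc_dist_eq0 (hub_broadcast v)) e trunc_dist_eq0.
move=> [i|[x a]] [j|[y b]] uv; try by apply: self => //; (left + right).
case: (eqVneq x y) uv => [<-{y}|xy] uv.
  (* Both vertices of one path: a hub in [x] is adjacent to the middle vertex only; if [x] is empty,
     the middle vertex broadcasts. *)
  have [x0|[i ix]] := set_0Vmem x.
    apply: self => //; rewrite /= x0 eqxx.
    by case: a b uv => [] [] // _; [left|right].
  exists (hub i); split=> //= e; apply: uv.
  have := path_hub_le1 x a i; rewrite /path_vertex e path_hub_le1 ix !andbT.
  by move=> ->.
(* Different paths: a hub in exactly one of [x] and [y] is within distance 2 of exactly one of the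
   two vertices. *)
have [i ixy]: exists i, (i \in x) != (i \in y).
  apply/existsP; apply: contraNT xy; rewrite negb_exists => /forallP e.
  by apply/eqP/setP => i; apply/eqP; have := e i; rewrite negbK.
exists (hub i); split=> //= e; move/negP: ixy; apply; apply/eqP.
by rewrite -(path_hub_le2 x a) -(path_hub_le2 y b) /path_vertex e.
Qed.

(** The hubs cost [2 * m], the middle vertex of the empty set 2 more. *)
Lemma bdim_hub_graph : bdim hub_graph <= 2 * m.+1.
Proof.
apply: leq_trans (bdim_le hub_broadcast_resolving) _.
rewrite big_sumType /= sum_nat_const card_ord mulnC mulnS addnC leq_add2r.
rewrite (bigD1 (finset.set0, true)) //= eqxx big1 // => -[x b] /=.
by rewrite xpair_eqE; case: b; rewrite ?andbT ?andbF // => /negbTE ->.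
Qed.

Lemma adim_hub_graph : 2 ^ m <= (adim hub_graph).+1.
Proof.
have [A AP <-] := adim_attained hub_graph.
pose label (v : hub_graph) := if v is inr (x, _) then x else finset.set0.
pose missed := [set x : {set 'I_m} | (path_vertex x false \notin A) &&
                                     (path_vertex x true \notin A)]%SET.
have missed1 : #|missed| <= 1.
  apply/card_le1_eqP => x y; rewrite !inE => /andP[xf xt] /andP[yf yt].
  apply/eqP/negPn/negP => xy.
  (* The closed neighbourhood of a leaf is its path, so the leaf of a missed path is at truncated
     distance 2 from all of [A]; two such leaves are not resolved. *)
  have far z (w : {set 'I_m}) : z \in A -> path_vertex w false \notin A ->
      path_vertex w true \notin A -> trunc_dist 1 (path_vertex w false) z = 2.
    move=> zA wf wt; apply/eqP; rewrite eqn_leq trunc_dist_leS ltnNge.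
    rewrite trunc_dist_le1 //; apply/norP; split.
      by apply: contraNneq wf => ->.
    case: z zA => [i|[v b]] //= zA; apply: contraNN wt => /andP[/eqP ->].
    by case: b zA.
  have [|z zA] := AP (path_vertex x false) (path_vertex y false).
    by case=> e; rewrite e eqxx in xy.
  by rewrite !far.
have hitA : ~: missed \subset label @: A.
  apply/fintype.subsetP => x; rewrite !inE negb_and !negbK => /orP[] xA.
    by apply/imsetP; exists (path_vertex x false).
  by apply/imsetP; exists (path_vertex x true).
have card_sets : #|{set 'I_m}| = 2 ^ m.
  by rewrite -cardsT -powersetT card_powerset cardsT card_ord.
rewrite -card_sets -(cardsC missed) -[#|A|.+1]add1n leq_add //.
exact: leq_trans (subset_leq_card hitA) (leq_imset_card _ _).
Qed.

End HubGraph.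

Local Open Scope classical_set_scope.
Local Open Scope ring_scope.

Theorem theorem1p5 (R : realType) :
  (exists2 c : R, 0 < c &
     forall G : sgraph, c * ln (adim G)%:R <= (bdim G)%:R) /\
  (exists G : nat -> sgraph,
     (adim (G i) @[i --> \oo] --> \oo) /\
     (fun i : nat => (bdim (G i))%:R : R)
       =O_\oo (fun i : nat => ln (adim (G i))%:R : R)).
Proof.
split.
  have ln3 : 0 < ln 3 :> R by rewrite ln_gt0 ?ltr1n.
  exists (ln 3)^-1; rewrite ?invr_gt0 // => G; rewrite ler_pdivrMl // mulr_natr.
  have [f fP <-] := bdim_attained G.
  case: (posnP (adim G)) => [->|adim_gt0].
    (* By convention [ln 0] is 0. *)
    by rewrite ln0 // mulrn_wge0 // ltW.
  rewrite -lnXn // -natrX ler_ln ?posrE ?ltr0n ?expn_gt0 // ler_nat.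
  exact: leq_trans (adim_le_card G) (card_le_broadcast fP).
(* The shift absorbs the loss of 1 in [adim_hub_graph] and keeps the logarithm positive. *)
exists (fun i => hub_graph i.+2).
have adim_ge i : (2 ^ i.+1 <= adim (hub_graph i.+2))%N.
  rewrite -ltnS; apply: leq_trans (adim_hub_graph i.+2).
  by rewrite ltn_exp2l.
split.
  apply/cvgnyPge => N; near=> i.
  apply: leq_trans (adim_ge i); apply: leq_trans (ltnW (ltn_expl i.+1 _)) => //.
  apply: leqW; near: i; exact: nbhs_infty_ge.
have ln2 : 0 < ln 2 :> R by rewrite ln_gt0 ?ltr1n.
(* The constant comes from [2 * (i + 3) <= 6 * (i + 1)] and the bound [2 ^ i.+1] on [adim]. *)
apply/eqO_exP; exists (6 / ln 2); first by rewrite divr_gt0.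
apply: nearW => i /=.
have adim_ln : i.+1%:R * ln 2 <= ln (adim (hub_graph i.+2))%:R :> R.
  have adim_gt0 : (0 < adim (hub_graph i.+2))%N.
    by apply: leq_trans (adim_ge i); rewrite expn_gt0.
  by rewrite mulr_natl -lnXn // -natrX ler_ln ?posrE ?ltr0n ?expn_gt0 ?ler_nat.
rewrite ger0_norm // ger0_norm; last first.
  by apply: le_trans adim_ln; rewrite mulr_ge0 // ltW.
rewrite mulrAC ler_pdivlMr //; apply: le_trans (ler_wpM2l _ adim_ln) => //.
rewrite mulrA ler_pM2r // -natrM ler_nat.
apply: leq_trans (bdim_hub_graph _) _.
by rewrite -[6%N]/(2 * 3)%N -mulnA leq_pmul2l // mulSn -addn2
  leq_add2l leq_pmulr.
Unshelve. all: by end_near.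
Qed.
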